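(* Let $\mathcal{V}$ be a Euclidean Jordan algebra of rank $n$ with unit element $e$, let $p\in\mathcal{V}$ have distinct eigenvalues, and let $\{T_k\}$ be a sequence of positive linear transformations on $\mathcal{V}$ such that $T_k(h)\to h$ as $k\to\infty$ for all $h\in\{e,p,p^2\}$. Let $p=p_1e_1+p_2e_2+\cdots+p_ne_n$ be the spectral decomposition of $p$ (with $\{e_1,\ldots,e_n\}$ a Jordan frame). Then $$T_k(h)\to h\quad\text{and}\quad T_k^*(h)\to h$$ for all $h\in\operatorname{span}\{e_1,e_2,\ldots,e_n\}$.
   Context: A Euclidean Jordan algebra is a finite-dimensional real inner product space $(\mathcal{V},\langle\cdot,\cdot\rangle)$ with a bilinear product $(x,y)\mapsto x\circ y$ satisfying $x\circ y=y\circ x$, $x\circ(x^2\circ y)=x^2\circ(x\circ y)$ with $x^2=x\circ x$, and $\langle x\circ y,z\rangle=\langle x,y\circ z\rangle$. It has a unit element $e$ (with $x\circ e=x$ for all $x$). Its symmetric cone is $K=\{x\circ x:x\in\mathcal{V}\}$; write $x\ge 0$ when $x\in K$. A nonzero $c$ with $c^2=c$ is an idempotent; it is primitive if it is not the sum of two other (nonzero) idempotents. A Jordan frame is a set $\{e_1,\ldots,e_n\}$ of mutually orthogonal primitive idempotents (equivalently, $e_i\circ e_j=0$ for $i\ne j$) with sum $e$; all Jordan frames have the same number $n$ of elements, called the rank of $\mathcal{V}$. By the spectral decomposition theorem every $x\in\mathcal{V}$ can be written $x=x_1e_1+\cdots+x_ne_n$ with real numbers $x_i$ (the eigenvalues of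 $x$, which do not depend on the decomposition) and some Jordan frame $\{e_1,\ldots,e_n\}$; if the eigenvalues are distinct, this decomposition is unique up to permutation. A linear transformation $T:\mathcal{V}\to\mathcal{V}$ is positive if $x\ge0\Rightarrow T(x)\ge0$. $T^*$ is the adjoint of $T$ with respect to the given inner product. Convergence is with respect to the norm of the finite-dimensional space $\mathcal{V}$. *)

(* Defs.v *)
From HB Require Import structures.
From mathcomp Require Import all_boot all_order all_algebra.
From mathcomp Require Import boolp classical_sets reals topology normedtype.

Set Implicit Arguments.
Unset Strict Implicit.
Unset Printing Implicit Defensive.

Import Order.TTheory GRing.Theory Num.Theory.
Import numFieldNormedType.Exports.

Local Open Scope classical_set_scope.
Local Open Scope ring_scope.

(* Left linearity in the first argument together with symmetry makes both
   [jprod] and [jip] bilinear. The existence of a unit does not follow from the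
   other axioms (take the zero product), so it is part of the structure. *)
Record euclideanJordanAlgebra (R : realType) (V : vectType R) :=
  EuclideanJordanAlgebra {
  jip : V -> V -> R;
  jprod : V -> V -> V;
  junit : V;
  jip_linearl : forall (a : R) (x y z : V),
    jip (a *: x + y) z = a * jip x z + jip y z;
  jipC : forall x y : V, jip x y = jip y x;
  jip_gt0 : forall x : V, x != 0 -> 0 < jip x x;
  jprod_linearl : forall (a : R) (x y z : V),
    jprod (a *: x + y) z = a *: jprod x z + jprod y z;
  jprodC : forall x y : V, jprod x y = jprod y x;
  jprod_jordan : forall x y : V,
    jprod x (jprod (jprod x x) y) = jprod (jprod x x) (jprod x y);
  jip_prod : forall x y z : V, jip (jprod x y) z = jip x (jprod y z);
  jprodx1 : forall x : V, jprod x junit = x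
}.

Section Notions.
Context {R : realType} {V : vectType R} (A : euclideanJordanAlgebra V).
Implicit Types (x y c : V) (T S : 'End(V)).

Definition jsquare x : V := jprod A x x.

Definition jnorm x : R := Num.sqrt (jip A x x).

Definition jcvg (u : nat -> V) (l : V) : Prop :=
  (fun k => jnorm (u k - l)) @ \oo --> (0 : R).

Definition symmetric_cone : set V := range jsquare.

Definition positive_map T : Prop :=
  forall x, symmetric_cone x -> symmetric_cone (T x).

Definition idempotent c : Prop := c != 0 /\ jsquare c = c.

Definition primitive_idempotent c : Prop :=
  idempotent c /\
  ~ (exists a b : V, [/\ idempotent a, idempotent b & c = a + b]).

(* Two idempotents are orthogonal when their Jordan product vanishes. The
   vectors of a frame, being nonzero, are then pairwise distinct, so that a
   frame with n elements is the same as a family indexed by 'I_n. *)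
Definition jordan_frame (n : nat) (c : 'I_n -> V) : Prop :=
  [/\ forall i, primitive_idempotent (c i),
      forall i j, i != j -> jprod A (c i) (c j) = 0
    & \sum_(i < n) c i = junit A].

(* All Jordan frames have the same number of elements, so n is the rank as soon
   as one frame has n elements. *)
Definition has_rank (n : nat) : Prop := exists c : 'I_n -> V, jordan_frame c.

Definition spectral_decomposition (n : nat) x (lam : 'I_n -> R)
    (c : 'I_n -> V) : Prop :=
  jordan_frame c /\ x = \sum_(i < n) lam i *: c i.

Definition is_adjoint T S : Prop :=
  forall x y, jip A (T x) y = jip A x (S y).

(* The default value 0 is never used: see [adjointP] and [is_adjoint_uniq]. *)
Definition adjoint T : 'End(V) := xget 0 [set S | is_adjoint T S].

Lemma jip_linearr (a : R) x y z :
  jip A z (a *: x + y) = a * jip A z x + jip A z y.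
Proof. by rewrite jipC jip_linearl !(jipC A z). Qed.

Lemma jip0l y : jip A 0 y = 0.
Proof.
have := jip_linearl A 1 0 0 y.
by rewrite scale1r addr0 mul1r => /esym/(canRL (addKr _)); rewrite addNr.
Qed.

Lemma jip_eq0 x : (forall y, jip A y x = 0) -> x = 0.
Proof.
move=> x0; apply/eqP; apply: contraT => /(jip_gt0 A).
by rewrite x0 ltxx.
Qed.

Let b : (\dim (@fullv R V)).-tuple V := vbasis fullv.

Definition gram (f : V -> V) y : V :=
  \sum_(i < \dim (@fullv R V)) jip A (f b`_i) y *: b`_i.

Lemma gram_linear f : linear (gram f).
Proof.
move=> a x y; rewrite /gram scaler_sumr -big_split; apply: eq_bigr => i _ /=.
by rewrite jip_linearr scalerDl scalerA.
Qed.

HB.instance Definition _ f :=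
  GRing.isLinear.Build R V V *:%R (gram f) (gram_linear f).

Lemma gram_inj f g x y : gram f x = gram g y ->
  forall i : 'I_(\dim (@fullv R V)), jip A (f b`_i) x = jip A (g b`_i) y.
Proof.
have /freeP bfree : free b := basis_free (vbasisP fullv).
move=> fg i; apply/eqP; rewrite -subr_eq0; apply/eqP.
apply: (bfree (fun i => jip A (f b`_i) x - jip A (g b`_i) y)).
under eq_bigr do rewrite scalerBl.
by rewrite sumrB; move: fg; rewrite /gram => ->; rewrite subrr.
Qed.

Lemma basis_jip_ext (f g : 'End(V)) x y :
  (forall i : 'I_(\dim (@fullv R V)), jip A (f b`_i) x = jip A (g b`_i) y) ->
  forall z, jip A (f z) x = jip A (g z) y.
Proof.
move=> fg z; rewrite (coord_vbasis (memvf z)) !linear_sum.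
elim/big_ind2: _ => [|u u' v v' uu' vv'|i _]; first by rewrite !jip0l.
  have := jip_linearl A 1 u' v' x; have := jip_linearl A 1 u v y.
  by rewrite !scale1r !mul1r uu' vv' => -> ->.
have := jip_linearl A (coord b i z) (f b`_i) 0 x.
have := jip_linearl A (coord b i z) (g b`_i) 0 y.
by rewrite !linearZ !addr0 !jip0l !addr0 fg => -> ->.
Qed.

Lemma adjointP T : is_adjoint T (adjoint T).
Proof.
apply: (@xgetPex _ 0 [set S | is_adjoint T S]).
pose G : 'End(V) := linfun (gram id).
exists (G^-1 \o linfun (gram T))%VF => x y.
have kerG : lker G == 0%VS.
  apply/eqP/vspaceP => u; rewrite memv_ker memv0 lfunE /=.
  apply/eqP/eqP => [gu|->]; last by rewrite linear0.
  apply: jip_eq0 => v; rewrite -[v](id_lfunE v) -(jip0l 0).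
  transitivity (jip A (\1%VF v) 0); last by rewrite jipC !jip0l.
  apply: basis_jip_ext => i; rewrite !id_lfunE.
  by apply: (@gram_inj id id); rewrite gu linear0.
rewrite comp_lfunE -[x in RHS](id_lfunE x).
apply: basis_jip_ext => i; rewrite id_lfunE.
by apply: (@gram_inj T id); rewrite -[RHS]lfunE -/G lker0_lfunVK // lfunE.
Qed.

Lemma is_adjoint_uniq T S : is_adjoint T S -> S = adjoint T.
Proof.
move=> TS; apply/lfunP => y; apply/eqP; rewrite -subr_eq0; apply/eqP.
apply: jip_eq0 => x.
rewrite addrC -scaleN1r jip_linearr -TS -adjointP.
by rewrite mulN1r addNr.
Qed.

End Notions.

(* Main.v *)
(* Write s = |c|^2 for a primitive idempotent c with Peirce operator L = L(c).

   The Jordan identity gives 2L^3 - 3L^2 + L = 0, whence <y, cy> >= |cy|^2 >= 0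
   for every idempotent c. The eigenspace L = 1 is the line spanned by c:
   otherwise the quartic 4<x^2, x> - 3|x|^4 has a maximizer x0 != 0 on it;
   x0^2 = |x0|^2 x0 by the first-order condition, so x0 / |x0|^2 is an
   idempotent, equal to c by primitivity, and the second-order condition at x0
   fails in every direction orthogonal to c.

   Consequently a square x, or an x nonnegative on squares, is close to c as
   soon as <x, e> and <x, c> are both close to s, with explicit estimates. This
   applies to T_k c_i and to T_k^* c_i because <T_k c_i, c_j> -> <c_i, c_j>: for
   i != j, the nonnegative number (p_i - p_j)^2 <T_k c_i, c_j> is at most
   <T_k (p - p_j e)^2, c_j>, which tends to <(p - p_j e)^2, c_j> = 0; the case
   i = j follows by summing, since T_k e -> e. *)
Require Import Defs.
From mathcomp Require Import all_boot all_order all_algebra.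
From mathcomp Require Import boolp classical_sets reals topology normedtype.
From mathcomp Require Import derive realfun.
From mathcomp Require Import ring lra.
Import Order.TTheory GRing.Theory Num.Theory.
Import numFieldNormedType.Exports.
Import VectorInternalTheory.
Local Open Scope classical_set_scope.
Local Open Scope ring_scope.

Set Implicit Arguments.
Unset Strict Implicit.
Unset Printing Implicit Defensive.

(** * Inequalities for real polynomials and limits of finite sums *)

Lemma quadratic_ge0_discr (R : realFieldType) (a b c : R) :
  0 <= a -> (forall t, 0 <= a * t ^+ 2 + 2 * b * t + c) -> b ^+ 2 <= a * c.
Proof.
move=> a_ge0 q_ge0; have [a_gt0|a_le0] := ltP 0 a.
  have := q_ge0 (- b / a).
  have -> : a * (- b / a) ^+ 2 + 2 * b * (- b / a) + c = (a * c - b ^+ 2) / a.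
    by field; rewrite gt_eqF.
  by rewrite pmulr_lge0 ?invr_gt0 // subr_ge0.
have a0 : a = 0 by apply/eqP; rewrite eq_le a_le0.
have [->|b_neq0] := eqVneq b 0; first by rewrite a0 mul0r expr0n.
(* Now the polynomial is affine with nonzero slope, and it takes the value -1 at this point. *)
have := q_ge0 (- (1 + c) / b / 2).
have -> : a * (- (1 + c) / b / 2) ^+ 2 + 2 * b * (- (1 + c) / b / 2) + c = -1.
  by rewrite a0; field.
by rewrite lerNr oppr0 ler10.
Qed.

(** First- and second-order conditions at a maximum, for a function that is quartic along lines. *)
Lemma quartic_le0 (R : realFieldType) (a b c d : R) :
  (forall t, t * a + t ^+ 2 * b + t ^+ 3 * c + t ^+ 4 * d <= 0) ->
  a = 0 /\ b <= 0.
Proof.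
move=> le0.
(* Averaging over t and -t cancels the odd powers. *)
have even t : t ^+ 2 * (b + t ^+ 2 * d) <= 0.
  by have := le0 t; have := le0 (- t); rewrite !exprS !expr0; lra.
have b_le0 : b <= 0.
  rewrite leNgt; apply/negP => b_gt0.
  pose D := b + `|d| + 1; have dD := ler_norm (- d); rewrite normrN in dD.
  have D_gt0 : 0 < D by rewrite /D; have := normr_ge0 d; lra.
  have := even (b / D); apply/negP; rewrite -ltNge.
  rewrite pmulr_rgt0 ?exprn_gt0 ?divr_gt0 //.
  have -> : b + (b / D) ^+ 2 * d = b / D ^+ 2 * (D ^+ 2 + b * d).
    by field; rewrite gt_eqF.
  rewrite pmulr_rgt0 ?divr_gt0 ?exprn_gt0 // expr2.
  have := normr_ge0 d; rewrite /D => dge; nra.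
split=> //; apply/eqP; apply: contraT => a_neq0.
(* At t = a / D the linear term equals D t^2, while the others add up to at most K t^2 in absolute
   value, and K < D. *)
pose K := `|b| + `|c| + `|d|; pose D := K + `|a| + 1.
have [a0 b0] := (normr_ge0 a, normr_ge0 b).
have [c0 d0] := (normr_ge0 c, normr_ge0 d).
have D_gt0 : 0 < D by rewrite /D /K; lra.
pose t := a / D.
have t1 : `|t| <= 1.
  by rewrite /t normrM normfV (gtr0_norm D_gt0) ler_pdivrMr // mul1r /D /K; lra.
have tail : `|b + t * c + t ^+ 2 * d| <= K.
  rewrite /K; apply: le_trans (ler_normD _ _) _; apply: lerD; last first.
    by rewrite normrM ler_piMl // normrX exprn_ile1.
  apply: le_trans (ler_normD _ _) _; rewrite lerD2l normrM.
  by rewrite ler_piMl.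
have := le0 t.
have -> : t * a + t ^+ 2 * b + t ^+ 3 * c + t ^+ 4 * d =
   t ^+ 2 * (D + (b + t * c + t ^+ 2 * d)).
  by rewrite /t; field; rewrite gt_eqF.
rewrite pmulr_rle0; last first.
  by rewrite exprn_even_gt0 //= /t mulf_neq0 ?invr_eq0 // gt_eqF.
move: tail; rewrite ler_norml /D; lra.
Qed.

Lemma cvg_sumr (R : realType) (I : finType) (P : pred I) (u : I -> nat -> R)
    (a : I -> R) : (forall i, P i -> u i @ \oo --> a i) ->
  (fun k => \sum_(i | P i) u i k) @ \oo --> \sum_(i | P i) a i.
Proof.
move=> ua; apply: (@cvg_big _ _ _ _ _ _ nat \oo _ u a) => //.
exact: add_continuous.
Qed.

(** * Bilinearity *)

Section Algebra.
Context {R : realType} {V : vectType R} (A : euclideanJordanAlgebra V).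
Implicit Types (x y z u w c d : V).

Local Notation "x ** y" := (jprod A x y) (at level 40, left associativity).
Local Notation "''[' x , y ]" := (jip A x y).
Local Notation e := (junit A).

Lemma jipDl x y z : '[x + y, z] = '[x, z] + '[y, z].
Proof. by rewrite -[x in LHS]scale1r jip_linearl mul1r. Qed.

Lemma jipZl a x z : '[a *: x, z] = a * '[x, z].
Proof. by rewrite -[a *: x]addr0 jip_linearl jip0l addr0. Qed.

Lemma jipNl x z : '[- x, z] = - '[x, z].
Proof. by rewrite -scaleN1r jipZl mulN1r. Qed.

Lemma jipDr x y z : '[z, x + y] = '[z, x] + '[z, y].
Proof. by rewrite jipC jipDl !(jipC A z). Qed.

Lemma jipZr a x z : '[z, a *: x] = a * '[z, x].
Proof. by rewrite jipC jipZl (jipC A z). Qed.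

Lemma jipNr x z : '[z, - x] = - '[z, x].
Proof. by rewrite jipC jipNl (jipC A z). Qed.

Lemma jip0r x : '[x, 0] = 0.
Proof. by rewrite jipC jip0l. Qed.

Lemma jip_suml (I : finType) (F : I -> V) z :
  '[\sum_i F i, z] = \sum_i '[F i, z].
Proof.
by elim/big_rec2: _ => [|i a b _ <-]; rewrite ?jip0l // jipDl.
Qed.

Lemma jip_sumr (I : finType) (G : I -> V) z :
  '[z, \sum_i G i] = \sum_i '[z, G i].
Proof. by rewrite jipC jip_suml; apply: eq_bigr => i _; rewrite jipC. Qed.

Lemma jip_ge0 x : 0 <= '[x, x].
Proof. by have [->|/(jip_gt0 A)/ltW//] := eqVneq x 0; rewrite jip0l. Qed.

Lemma jipxx_eq0 x : '[x, x] = 0 -> x = 0.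
Proof.
by move=> xx0; apply: contraTeq isT => /(jip_gt0 A); rewrite xx0 ltxx.
Qed.

Lemma jip_ext x y : (forall w, '[w, x] = '[w, y]) -> x = y.
Proof.
move=> xy; apply/subr0_eq/(@jip_eq0 _ _ A) => w.
by rewrite jipDr jipNr xy subrr.
Qed.

Lemma jprodDl x y z : (x + y) ** z = x ** z + y ** z.
Proof. by rewrite -[x in LHS]scale1r jprod_linearl scale1r. Qed.

Lemma jprod0l z : 0 ** z = 0.
Proof. by apply: (addrI (0 ** z)); rewrite -jprodDl !addr0. Qed.

Lemma jprodZl a x z : (a *: x) ** z = a *: (x ** z).
Proof. by rewrite -[a *: x]addr0 jprod_linearl jprod0l addr0. Qed.

Lemma jprodNl x z : (- x) ** z = - (x ** z).
Proof. by rewrite -scaleN1r jprodZl scaleN1r. Qed.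

Lemma jprodDr x y z : z ** (x + y) = z ** x + z ** y.
Proof. by rewrite jprodC jprodDl !(jprodC A z). Qed.

Lemma jprod0r z : z ** 0 = 0.
Proof. by rewrite jprodC jprod0l. Qed.

Lemma jprodZr a x z : z ** (a *: x) = a *: (z ** x).
Proof. by rewrite jprodC jprodZl (jprodC A z). Qed.

Lemma jprodNr x z : z ** (- x) = - (z ** x).
Proof. by rewrite jprodC jprodNl (jprodC A z). Qed.

Lemma jprod_sumr (I : finType) (F : I -> V) z :
  z ** (\sum_i F i) = \sum_i z ** F i.
Proof. by elim/big_rec2: _ => [|i a b _ <-]; rewrite ?jprod0r // jprodDr. Qed.

Lemma jprod_suml (I : finType) (G : I -> V) z :
  (\sum_i G i) ** z = \sum_i G i ** z.
Proof. by rewrite jprodC jprod_sumr; apply: eq_bigr => i _; rewrite jprodC. Qed.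

Lemma jprod1x x : e ** x = x.
Proof. by rewrite jprodC jprodx1. Qed.

Let jE := (jprodDl, jprodDr, jprodNl, jprodNr, jprodZl, jprodZr,
  jipDl, jipDr, jipNl, jipNr, jipZl, jipZr).

(* Half the difference of the Jordan identities at [x + z] and [x - z]; the
   term cubic in [z] cancels by the identity at [z]. *)
Lemma jordan_linearized x y z :
  2 *: (x ** ((x ** z) ** y)) + z ** ((x ** x) ** y) =
  2 *: ((x ** z) ** (x ** y)) + (x ** x) ** (z ** y).
Proof.
apply: jip_ext => w.
have /(congr1 (jip A w)) hp := jprod_jordan A (x + z) y.
have /(congr1 (jip A w)) hm := jprod_jordan A (x - z) y.
have /(congr1 (jip A w)) hz := jprod_jordan A z y.
move: hp hm hz; rewrite !(jprodDl, jprodDr, jprodNl, jprodNr) (jprodC A z x).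
rewrite !jE => hp hm hz; lra.
Qed.

(** * Peirce operators of idempotents *)

Lemma peirce c y (cc : c ** c = c) :
  2 *: (c ** (c ** (c ** y))) = 3 *: (c ** (c ** y)) - c ** y.
Proof.
have := jordan_linearized c c y.
rewrite !cc (jprodC A y c) (jprodC A (c ** y) c) => h.
by apply: jip_ext => w; move/(congr1 (jip A w)): h; rewrite !jE => h; lra.
Qed.

(** With L the self-adjoint multiplication by [c], this is L = L^2 + 4 (L - L^2)^2, which holds at
    the roots 0, 1/2, 1 of the Peirce polynomial. It writes <y, L y> as a sum of squares. *)
Lemma idem_jip c y (cc : c ** c = c) :
  '[y, c ** y] =
  '[c ** y, c ** y] + 4 * '[c ** y - c ** (c ** y), c ** y - c ** (c ** y)].
Proof.
have adj u w : '[c ** u, w] = '[u, c ** w] by rewrite jprodC jip_prod.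
have /(congr1 (jip A y)) h3 := peirce y cc.
have /(congr1 (jip A y)) h4 := peirce (c ** y) cc.
move: h3 h4; rewrite !jE !adj => h3 h4; lra.
Qed.

Lemma idem_jip_ge c y (cc : c ** c = c) : '[c ** y, c ** y] <= '[y, c ** y].
Proof. by rewrite (idem_jip y cc) lerDl mulr_ge0 ?jip_ge0. Qed.

Lemma idem_jip_ge0 c y (cc : c ** c = c) : 0 <= '[y, c ** y].
Proof. exact: le_trans (jip_ge0 _) (idem_jip_ge y cc). Qed.

Lemma idem_sub c d : c ** c = c -> d ** d = d -> c ** d = d ->
  (c - d) ** (c - d) = c - d.
Proof.
move=> cc dd cd; rewrite jprodDl !jE (jprodC A d c) cd cc dd opprK.
by rewrite addNr addr0.
Qed.

Lemma idem_jip_le c y (cc : c ** c = c) : '[y, c ** y] <= '[y, y].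
Proof.
have := idem_jip_ge0 y (idem_sub (jprodx1 A e) cc (jprod1x c)).
by rewrite !jE jprod1x subr_ge0.
Qed.

Lemma idem_compl_jip_le c y (cc : c ** c = c) :
  '[y - c ** y, y - c ** y] <= '[y, y] - '[y, c ** y].
Proof.
have := idem_jip_ge y (idem_sub (jprodx1 A e) cc (jprod1x c)).
by rewrite jprodDl jprodNl jprod1x [in X in _ <= X]jipDr jipNr.
Qed.

Lemma symmetric_cone_idem x c : symmetric_cone A x -> c ** c = c ->
  0 <= '[x, c].
Proof.
move=> [y _ <-] cc; rewrite /jsquare jip_prod (jprodC A y).
exact: idem_jip_ge0.
Qed.

(* [2 c(cy) - cy] is the component of [y] in the Peirce space of eigenvalue 1 *)
Definition peirce1 c y : V := 2 *: (c ** (c ** y)) - c ** y.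

Lemma peirce1_fixed c y (cc : c ** c = c) : c ** peirce1 c y = peirce1 c y.
Proof.
apply: jip_ext => w; have /(congr1 (jip A w)) := peirce y cc.
rewrite /peirce1 !jE; lra.
Qed.

Lemma jip_peirce1 c y (cc : c ** c = c) : '[peirce1 c y, c] = '[y, c].
Proof.
by rewrite /peirce1 !jE !(jprodC A c) !jip_prod !cc; ring.
Qed.

(** The left-hand vector is (1 + 2L)(1 - L) y, and 0 <= L <= 1 bounds the square of 1 + 2L by 9. *)
Lemma peirce1_rest_le c y (cc : c ** c = c) :
  '[y - peirce1 c y, y - peirce1 c y] <= 9 * '[y - c ** y, y - c ** y].
Proof.
have le9 w : '[w + 2 *: (c ** w), w + 2 *: (c ** w)] <= 9 * '[w, w].
  have := idem_jip_ge w cc; have := idem_jip_le w cc.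
  rewrite !jE (jipC A (c ** w) w); lra.
have -> : y - peirce1 c y = (y - c ** y) + 2 *: (c ** (y - c ** y)).
  by apply: jip_ext => z; rewrite /peirce1 !jE; ring.
exact: le9.
Qed.

(** The symmetric form sending z, w to <x, z w> is positive semidefinite. *)
Lemma cauchy_schwarz_form x z w : (forall y, 0 <= '[x, y ** y]) ->
  '[x, z ** w] ^+ 2 <= '[x, z ** z] * '[x, w ** w].
Proof.
move=> x_dual; apply: quadratic_ge0_discr => // t.
have := x_dual (t *: z + w).
rewrite !jE (jprodC A w z); congr (0 <= _); ring.
Qed.

Lemma cauchy_schwarz z w : '[z, w] ^+ 2 <= '[z, z] * '[w, w].
Proof.
apply: quadratic_ge0_discr (jip_ge0 z) _ => t.
have := jip_ge0 (t *: z + w).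
rewrite !jE (jipC A w z); congr (0 <= _); ring.
Qed.

(** Iterates |a + b|^2 <= 2 |a|^2 + 2 |b|^2; any constant independent of [G] serves for
    [jprod_bound]. *)
Lemma jip_sqr_sum (I : Type) (r : seq I) (G : I -> V) :
  '[\sum_(i <- r) G i, \sum_(i <- r) G i] <=
  2 ^+ size r * \sum_(i <- r) '[G i, G i].
Proof.
elim: r => [|i r IH]; first by rewrite !big_nil jip0l mulr0.
rewrite !big_cons /= exprS.
set S := \sum_(j <- r) G j in IH *; set B := \sum_(j <- r) _ in IH *.
have := jip_ge0 (G i - S); have p2 : 1 <= 2 ^+ size r :> R.
  by rewrite exprn_ege1 // ler1n.
have := jip_ge0 (G i); rewrite !jE (jipC A S) => gi; nra.
Qed.

(* Riesz representation of the coordinate functionals, through the adjoint of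
   the projections onto the coordinate axes. *)
Lemma dual_basis : exists m (b w : 'I_m -> V),
  forall x, x = \sum_i '[x, w i] *: b i.
Proof.
pose b i : V := r2v (delta_mx 0 i).
have b_neq0 i : '[b i, b i] != 0.
  rewrite gt_eqF ?jip_gt0 //; apply/eqP => /(congr1 v2r).
  rewrite r2vK linear0 => /matrixP/(_ 0 i)/eqP.
  by rewrite !mxE !eqxx oner_eq0.
pose T i : 'End(V) := linfun (r2v \o mulmxr (delta_mx i i) \o v2r).
exists _, b, (fun i => '[b i, b i]^-1 *: adjoint A (T i) (b i)) => x.
rewrite -[LHS]v2rK (row_sum_delta (v2r x)) linear_sum; apply: eq_bigr => i _.
rewrite linearZ jipZr -adjointP lfunE /=; congr (_ *: _).
have -> : v2r x *m delta_mx i i = v2r x 0 i *: delta_mx 0 i.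
  apply/rowP => j; rewrite !mxE (bigD1 i) //= big1 => [|k ki].
    by rewrite !mxE !eqxx addr0.
  by rewrite !mxE (negbTE ki) mulr0.
by rewrite linearZ jipZl mulrCA mulVf ?mulr1.
Qed.

(** Both factors are expanded by [dual_basis], and Cauchy-Schwarz bounds their coordinates. *)
Lemma jprod_bound : exists2 C : R, 0 <= C &
  forall x y, '[x ** y, x ** y] <= C * '[x, x] * '[y, y].
Proof.
have [m [b [w bw]]] := dual_basis.
pose D (p : 'I_m * 'I_m) : R :=
  '[w p.1, w p.1] * '[w p.2, w p.2] * '[b p.1 ** b p.2, b p.1 ** b p.2].
have D_ge0 p : 0 <= D p by rewrite !mulr_ge0 ?jip_ge0.
exists (2 ^+ size (index_enum ('I_m * 'I_m)%type) * \sum_p D p) => [|x y].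
  by rewrite mulr_ge0 ?exprn_ge0 ?sumr_ge0.
have -> : x ** y = \sum_(p : 'I_m * 'I_m)
    ('[x, w p.1] * '[y, w p.2]) *: (b p.1 ** b p.2).
  rewrite [in LHS](bw x) [in LHS](bw y) jprod_suml.
  under eq_bigr do rewrite jprod_sumr.
  rewrite pair_big; apply: eq_bigr => -[i j] _ /=.
  by rewrite jprodZl jprodZr scalerA.
apply: le_trans (jip_sqr_sum _ _) _; rewrite -!mulrA ler_wpM2l ?exprn_ge0 //.
rewrite mulr_suml; apply: ler_sum => -[i j] _; rewrite /D jipZl jipZr /=.
have := ler_pM (sqr_ge0 _) (sqr_ge0 _)
  (cauchy_schwarz x (w i)) (cauchy_schwarz y (w j)).
move=> /(ler_wpM2r (jip_ge0 (b i ** b j))).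
by congr (_ <= _); ring.
Qed.

(** * Continuity and convergence *)

(** [V] carries no topology here, so continuity of a [V]-valued map is tested through its pairings
    with fixed vectors. *)
Definition weakly_continuous (T : topologicalType) (f : T -> V) :=
  forall w, continuous (fun v => '[f v, w]).

Lemma weakly_continuous_jip (T : topologicalType) (f g : T -> V) :
  weakly_continuous f -> weakly_continuous g ->
  continuous (fun v => '[f v, g v]).
Proof.
move=> cf cg; have [m [b [w bw]]] := dual_basis.
have -> : (fun v => '[f v, g v]) = (fun v => \sum_i '[f v, w i] * '[g v, b i]).
  apply/funext => v; rewrite [in LHS](bw (f v)) jip_suml.
  by apply: eq_bigr => i _; rewrite jipZl (jipC A (b i)).
apply: continuous_big => [|i _]; first exact: add_continuous.
by move=> v; apply: cvgM; [exact: cf|exact: cg].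
Qed.

Lemma weakly_continuous_jprod (T : topologicalType) (f g : T -> V) :
  weakly_continuous f -> weakly_continuous g ->
  weakly_continuous (fun v => f v ** g v).
Proof.
move=> cf cg w.
under eq_fun do rewrite jip_prod.
apply: weakly_continuous_jip cf _ => z.
under eq_fun do rewrite jip_prod.
exact: cg.
Qed.

(** The limit [z] is kept apart from the proof that it vanishes, so that limit rules may deliver it
    as an unsimplified expression. *)
Lemma jcvg_squeeze (u : nat -> V) l (r : nat -> R) (z : R) :
  (forall k, '[u k - l, u k - l] <= r k) -> r @ \oo --> z -> z = 0 ->
  jcvg A u l.
Proof.
move=> ur rz z0; rewrite z0 in rz; rewrite /jcvg /jnorm -sqrtr0.
apply: continuous_cvg; first exact: sqrt_continuous.
apply: (squeeze_cvgr _ (cvg_cst 0) rz).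
by apply: nearW => k /=; rewrite jip_ge0 ur.
Qed.

(** Norm and weak convergence agree in finite dimension: by [dual_basis], |u k - l|^2 is a finite
    sum of products of pairings that tend to 0. *)
Lemma jcvgP (u : nat -> V) l :
  jcvg A u l <-> forall w, (fun k => '[u k, w]) @ \oo --> '[l, w].
Proof.
split=> [ul w|ul].
  have norm_le k : `|'[u k - l, w]| <= jnorm A (u k - l) * jnorm A w.
    rewrite /jnorm -sqrtrM ?jip_ge0 // -sqrtr_sqr.
    exact/ler_wsqrtr/cauchy_schwarz.
  have cvg0 : (fun k => jnorm A (u k - l) * jnorm A w) @ \oo --> (0 : R).
    by rewrite -(mul0r (jnorm A w)); exact: cvgMr_tmp.
  have dif0 : (fun k => '[u k - l, w]) @ \oo --> (0 : R).
    apply: (squeeze_cvgr _ _ cvg0); last by rewrite -oppr0; exact: cvgN cvg0.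
    by apply: nearW => k /=; rewrite -ler_norml.
  have -> : (fun k => '[u k, w]) = (fun k => '[u k - l, w] + '[l, w]).
    by apply/funext => k; rewrite jipDl jipNl subrK.
  by have := cvgD dif0 (cvg_cst '[l, w]); rewrite add0r; apply.
have [m [b [w bw]]] := dual_basis.
apply: (jcvg_squeeze _ (cvg_sumr (P := xpredT) (fun i _ =>
  cvgM (cvgB (ul (w i)) (cvg_cst '[l, w i]))
       (cvgB (ul (b i)) (cvg_cst '[l, b i]))))) => [k|].
  rewrite {1}(bw (u k - l)) jip_suml le_eqVlt.
  apply/orP; left; apply/eqP/eq_bigr => i _.
  by rewrite jipZl (jipC A (b i)) !jipDl !jipNl.
by apply: big1 => i _; rewrite !subrr mulr0.
Qed.

Lemma cubic_expand (t : R) x h :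
  '[(x + t *: h) ** (x + t *: h), x + t *: h] =
  '[x ** x, x] + 3 * t * '[x ** x, h] + 3 * t ^+ 2 * '[h ** h, x] +
  t ^+ 3 * '[h ** h, h].
Proof.
have xhx : '[x ** h, x] = '[x ** x, h] by rewrite jprodC jip_prod jipC.
have xhh : '[x ** h, h] = '[h ** h, x] by rewrite jip_prod jipC.
by rewrite !jE (jprodC A h x) xhx xhh; ring.
Qed.

Lemma norm_expand (t : R) x h :
  '[x + t *: h, x + t *: h] = '[x, x] + 2 * t * '[x, h] + t ^+ 2 * '[h, h].
Proof. by rewrite !jE (jipC A h x); ring. Qed.

(** * Primitive idempotents: the Peirce eigenvalue 1 and distance estimates *)

Section Primitive.
Context {c : V} (prim : primitive_idempotent A c).

(* The critical points of [F] are the solutions of [x ** x = |x|^2 *: x], so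
   every nonzero one is a positive multiple of an idempotent. *)
Let F x := 4 * '[x ** x, x] - 3 * '[x, x] ^+ 2.

Let F_expand (t : R) x h :
  F (x + t *: h) - F x =
  t * (12 * ('[x ** x, h] - '[x, x] * '[x, h])) +
  t ^+ 2 * (12 * '[h ** h, x] - 6 * '[x, x] * '[h, h] - 12 * '[x, h] ^+ 2) +
  t ^+ 3 * (4 * '[h ** h, h] - 12 * '[x, h] * '[h, h]) +
  t ^+ 4 * (- 3 * '[h, h] ^+ 2).
Proof. by rewrite /F cubic_expand norm_expand; ring. Qed.

Let primitive_fixed_max x0 : c ** x0 = x0 ->
    (forall x, c ** x = x -> F x <= F x0) ->
  forall x, c ** x = x -> x = ('[x, c] / '[c, c]) *: c.
Proof.
move=> cx0 x0max; have [[c_neq0 cc] c_prim] := prim.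
rewrite /jsquare in cc.
have s_gt0 := jip_gt0 A c_neq0; set s := '[c, c] in s_gt0 *.
have fixD t x h : c ** x = x -> c ** h = h -> c ** (x + t *: h) = x + t *: h.
  by move=> cx ch; rewrite !jE cx ch.
(* The linearized Jordan identity makes the eigenspace closed under squaring. *)
have fix_sqr x : c ** x = x -> c ** (x ** x) = x ** x.
  move=> cx; have := jordan_linearized c x x; rewrite !cc !cx.
  move=> h; apply: jip_ext => w; move/(congr1 (jip A w)): h.
  by rewrite !jE => h; lra.
have x0_neq0 : x0 != 0.
  (* [F] vanishes at 0 but equals s^-2 > 0 at this multiple of [c]. *)
  apply/eqP => x00; have := x0max (s^-1 *: c).
  rewrite !jE cc => /(_ erefl); rewrite /F !jE cc -/s x00 !jip0r.
  apply/negP; rewrite -ltNge.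
  have : 0 < s^-1 ^+ 2 by rewrite exprn_gt0 ?invr_gt0.
  have ss : s^-1 * s = 1 by field; rewrite gt_eqF.
  move=> ?; rewrite expr0n /= !mulr0 subr0 !ss mulr1; lra.
have N_gt0 := jip_gt0 A x0_neq0; set N := '[x0, x0] in N_gt0 *.
have perturb h : c ** h = h ->
    '[x0 ** x0, h] - N * '[x0, h] = 0 /\
    12 * '[h ** h, x0] - 6 * N * '[h, h] - 12 * '[x0, h] ^+ 2 <= 0.
  move=> ch; have [|/eqP] := quartic_le0
    (a := 12 * ('[x0 ** x0, h] - N * '[x0, h]))
    (b := 12 * '[h ** h, x0] - 6 * N * '[h, h] - 12 * '[x0, h] ^+ 2)
    (c := 4 * '[h ** h, h] - 12 * '[x0, h] * '[h, h]) (d := - 3 * '[h, h] ^+ 2).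
    by move=> t; rewrite -F_expand subr_le0 x0max ?fixD.
  by rewrite mulf_eq0 pnatr_eq0 => /eqP.
have x0x0 : x0 ** x0 = N *: x0.
  (* The defect [h] is itself an admissible direction, and the first-order condition along it reads
     |h|^2 = 0. *)
  apply/subr0_eq/jipxx_eq0; set h := _ - _.
  have ch : c ** h = h by rewrite /h !jE fix_sqr ?cx0.
  by have [h0 _] := perturb h ch; rewrite {1}/h jipDl jipNl jipZl.
have aa : (N^-1 *: x0) ** (N^-1 *: x0) = N^-1 *: x0.
  rewrite jprodZl jprodZr x0x0 (scalerA _ N) mulVf ?scale1r ?gt_eqF //.
have a_neq0 : N^-1 *: x0 != 0 by rewrite scaler_eq0 invr_eq0 gt_eqF.
have ac : c = N^-1 *: x0.
  apply: contrapT => /eqP; rewrite -subr_eq0 => b_neq0; apply: c_prim.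
  exists (N^-1 *: x0), (c - N^-1 *: x0); split=> //.
    by split=> //; apply: idem_sub; rewrite // jprodZr cx0.
  by rewrite addrC subrK.
have x0E : x0 = N *: c by rewrite ac scalerA mulfV ?scale1r // gt_eqF.
move=> x cx; apply/subr0_eq/jipxx_eq0; set h := x - _.
have hc : '[h, c] = 0.
  by rewrite /h !jE -/s mulfVK ?subrr // gt_eqF.
have ch : c ** h = h by rewrite /h !jE cx cc.
(* With x0 = N c and <h, c> = 0 the second-order condition becomes 12 N |h|^2 - 6 N |h|^2 <= 0. *)
clearbody h; have [_] := perturb h ch.
rewrite x0E !jE (jipC A c) hc jip_prod (jprodC A h) ch.
rewrite !mulr0 expr0n /= mulr0 subr0 => hh.
have := jip_ge0 h; nra.
Qed.

(** Compactness of a coordinate box, carried to the eigenspace by [peirce1 c]. Vectors of the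
    eigenspace that the box may miss are so long that [F] is at most F 0 = 0 there. *)
Let F_max : exists2 x0, c ** x0 = x0 & forall x, c ** x = x -> F x <= F x0.
Proof.
have [[_ cc] _] := prim; rewrite /jsquare in cc.
have [m [b [w bw]]] := dual_basis; have [C C_ge0 Cb] := jprod_bound.
pose X (v : 'rV[R]_m) := \sum_i v 0 i *: b i.
(* If |x|^2 > r, then <x^2, x>^2 <= C |x|^6 forces F x <= 0. If |x|^2 <= r, each coordinate of x has
   square at most rho - 1, so x comes from the box. *)
pose r := 2 * C + 1; pose rho := 1 + r * \sum_i '[w i, w i].
have w_ge0 : 0 <= \sum_i '[w i, w i].
  by rewrite sumr_ge0 // => i _; exact: jip_ge0.
have rho_ge1 : 1 <= rho by rewrite lerDl mulr_ge0 // /r; lra.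
have cX : weakly_continuous X.
  move=> z; rewrite /X.
  under eq_fun do rewrite jip_suml.
  apply: continuous_big => [|i _]; first exact: add_continuous.
  under eq_fun do rewrite jipZl.
  by move=> v; apply: (cvgM (@coord_continuous R 1 m 0 i v)); exact: cvg_cst.
have cP : weakly_continuous (fun v => peirce1 c (X v)).
  move=> z; suff -> : (fun v => '[peirce1 c (X v), z]) =
      (fun v => '[X v, peirce1 c z]) by exact: cX.
  apply/funext => v.
  by rewrite /peirce1 !jE !(jprodC A c) !jip_prod !(jprodC A c).
have cF : continuous (fun v => F (peirce1 c (X v))).
  have cN := weakly_continuous_jip cP cP.
  have cQ := weakly_continuous_jip (weakly_continuous_jprod cP cP) cP.
  move=> v; rewrite /F; under eq_fun do rewrite expr2.
  exact: (cvgB (cvgMl_tmp (cQ v)) (cvgMl_tmp (cvgM (cN v) (cN v)))).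
pose box := [set v : 'rV[R]_m | forall i, `[- rho, rho]%classic (v ord0 i)].
have [|||v0 v0box v0max] :=
  @compact_EVT_max _ _ (fun v => F (peirce1 c (X v))) box.
- by exists 0 => i /=; rewrite !mxE in_itv /= oppr_le0 andbb (le_trans ler01).
- apply: (@rV_compact _ _ (fun=> `[- rho, rho]%classic)) => _.
  exact: segment_compact.
- exact: continuous_subspaceT.
exists (peirce1 c (X v0)) => [|x cx]; first exact: peirce1_fixed.
have F0 : F 0 = 0 by rewrite /F !jip0r expr0n /= !mulr0 subr0.
have [N_le|N_gt] := leP '[x, x] r; last first.
  apply: (@le_trans _ _ 0).
    have := le_trans (cauchy_schwarz (x ** x) x)
      (ler_wpM2r (jip_ge0 x) (Cb x x)).
    have := jip_ge0 x; rewrite /F; set N := '[x, x] in N_gt *; set f := '[_, x].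
    move=> N_ge0 f_le; have : f ^+ 2 <= (3 / 4 * N ^+ 2) ^+ 2.
      apply: le_trans f_le _.
      have -> : (3 / 4 * N ^+ 2) ^+ 2 = 9 / 16 * N * N * N * N by field.
      rewrite !ler_wpM2r //; move: N_gt; rewrite /r; lra.
    have : 0 <= 3 / 4 * N ^+ 2 by rewrite mulr_ge0 ?sqr_ge0 //; lra.
    nra.
  have := v0max 0.
  have -> : peirce1 c (X 0) = 0.
    rewrite /X big1 => [|i _]; last by rewrite mxE scale0r.
    by rewrite /peirce1 !jprod0r scaler0 subr0.
  rewrite F0; apply; rewrite inE => i /=.
  by rewrite !mxE in_itv /= oppr_le0 andbb (le_trans ler01).
have := v0max (\row_i '[x, w i]).
have -> : X (\row_i '[x, w i]) = x.
  by rewrite [RHS]bw; apply: eq_bigr => i _; rewrite mxE.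
have -> : peirce1 c x = x.
  by rewrite /peirce1 !cx; apply: jip_ext => z; rewrite !jE; ring.
apply; rewrite inE => i /=; rewrite mxE in_itv /=.
have wi : '[w i, w i] <= \sum_i '[w i, w i].
  by rewrite (bigD1 i) //= lerDl sumr_ge0 // => j _; exact: jip_ge0.
have q_le : '[x, w i] ^+ 2 <= rho - 1.
  apply: le_trans (cauchy_schwarz _ _) _; rewrite /rho addrC addKr.
  by apply: ler_pM; rewrite ?jip_ge0.
by apply/andP; split; nra.
Qed.

Lemma primitive_fixed x : c ** x = x -> x = ('[x, c] / '[c, c]) *: c.
Proof.
by have [x0 cx0 x0max] := F_max; exact: (primitive_fixed_max cx0 x0max).
Qed.

(** By [primitive_fixed], [peirce1 c y] is the orthogonal projection of [y] on the line of [c];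
    Pythagoras then rewrites [peirce1_rest_le]. *)
Lemma primitive_rest_le y :
  '[y, y] - '[y, c] ^+ 2 / '[c, c] <= 9 * '[y - c ** y, y - c ** y].
Proof.
have [[c_neq0 cc] _] := prim; rewrite /jsquare in cc.
apply: le_trans (peirce1_rest_le y cc).
rewrite (primitive_fixed (peirce1_fixed y cc)) jip_peirce1 //.
rewrite le_eqVlt; apply/orP; left; apply/eqP.
by rewrite !jE (jipC A c y); field; rewrite gt_eqF ?jip_gt0.
Qed.

(** Since y^2 - c = (y - c)(y + c), the bound follows from |y - c|^2 |y + c|^2 = (|y|^2 - s)^2 + 4
    (s |y|^2 - <y, c>^2) with s = |c|^2; [primitive_rest_le] controls the last term, and 36 = 4 *
    9. *)
Lemma primitive_square_dist : exists C : R, forall y,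
  '[y ** y - c, y ** y - c] <=
  C * (('[y ** y, e] - '[c, c]) ^+ 2 +
       36 * '[c, c] * ('[y ** y, e] - '[y ** y, c])).
Proof.
have [[c_neq0 cc] _] := prim; rewrite /jsquare in cc.
have s_gt0 := jip_gt0 A c_neq0.
have [C C_ge0 Cb] := jprod_bound; exists C => y.
rewrite !jip_prod jprodx1 (jprodC A y c).
have -> : y ** y - c = (y - c) ** (y + c).
  by rewrite !jE cc (jprodC A y c); apply: jip_ext => z; rewrite !jE; ring.
apply: le_trans (Cb _ _) _; rewrite -mulrA ler_wpM2l //.
have := le_trans (primitive_rest_le y) (ler_wpM2l _ (idem_compl_jip_le y cc)).
move=> /(_ (ler0n _ _)) /(ler_wpM2l (ltW s_gt0)).
rewrite mulrBr mulrCA mulfV ?gt_eqF // mulr1 => h.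
by rewrite !jE (jipC A c y); move: h; rewrite !expr2; lra.
Qed.

(** By [primitive_rest_le], |x|^2 - <x, c>^2 / <c, c> is at most 9 |x - c x|^2, and x - c x = x (e -
    c) is small when <x, e - c> is. *)
Lemma primitive_dual_dist : exists C : R, forall x,
    (forall y, 0 <= '[x, y ** y]) ->
  '[x - c, x - c] <=
  ('[x, c] - '[c, c]) ^+ 2 / '[c, c] + C * ('[x, e] * ('[x, e] - '[x, c])).
Proof.
have [[c_neq0 cc] _] := prim; rewrite /jsquare in cc.
have s_gt0 := jip_gt0 A c_neq0.
have [C C_ge0 Cb] := jprod_bound; exists (9 * C) => x x_dual.
(* For w = x d, <x, d w> = |w|^2, so [cauchy_schwarz_form] gives |w|^4 <= <x, d> <x, w^2>. Squaring,
   bounding <x, w^2>^2 by C |x|^2 |w|^4 and cancelling |w|^4 yields the claim, used at [e] and at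
   [e - c]. *)
have idem_le d : d ** d = d ->
    '[x ** d, x ** d] ^+ 2 <= C * '[x, d] ^+ 2 * '[x, x].
  move=> dd; set w := x ** d.
  have := cauchy_schwarz_form d w x_dual.
  rewrite -jip_prod -/w dd => h1.
  have h2 := le_trans (cauchy_schwarz x (w ** w))
    (ler_wpM2l (jip_ge0 x) (Cb w w)).
  have w_ge0 := jip_ge0 w.
  have [->|w_neq0] := eqVneq '[w, w] 0.
    by rewrite expr0n /= mulr_ge0 ?jip_ge0 // mulr_ge0 ?sqr_ge0.
  have w_gt0 : 0 < '[w, w] by rewrite lt_neqAle eq_sym w_neq0.
  rewrite -(ler_pM2r (exprn_gt0 2 w_gt0)).
  have xd_ge0 : 0 <= '[x, d] by rewrite -dd x_dual.
  have h3 : ('[w, w] ^+ 2) ^+ 2 <= ('[x, d] * '[x, w ** w]) ^+ 2.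
    by rewrite ler_sqr ?nnegrE ?sqr_ge0 ?mulr_ge0.
  rewrite -expr2 (le_trans h3) // exprMn.
  have -> : C * '[x, d] ^+ 2 * '[x, x] * '[w, w] ^+ 2 =
    '[x, d] ^+ 2 * ('[x, x] * (C * '[w, w] * '[w, w])) by ring.
  by rewrite ler_wpM2l ?sqr_ge0.
have := idem_le e (jprodx1 A e).
have := idem_le (e - c) (idem_sub (jprodx1 A e) cc (jprod1x c)).
rewrite jprodx1 [x ** _]jprodC [(e - c) ** x]jprodDl jprodNl jprod1x.
rewrite [ '[x, e - c]]jipDr jipNr.
have := primitive_rest_le x; rewrite [c ** x]jprodC.
set W := '[x - x ** c, _]; set P := '[x, x]; set N := '[x, e]; set M := '[x, c].
move=> rest leW leP.
have M_ge0 : 0 <= M by rewrite /M -cc.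
have NM_ge0 : 0 <= N - M.
  have := x_dual (e - c); rewrite idem_sub ?jprodx1 ?jprod1x //.
  by rewrite jipDr jipNr.
have P_le : P <= C * N ^+ 2.
  have [P_gt0|P_le0] := ltP 0 P.
    by rewrite -(ler_pM2r P_gt0) -expr2.
  by apply: le_trans P_le0 _; rewrite mulr_ge0 ?sqr_ge0.
have W_le : W <= C * (N * (N - M)).
  have N_ge0 : 0 <= N by lra.
  rewrite -ler_sqr ?nnegrE ?jip_ge0 ?mulr_ge0 //.
  apply: le_trans leW _.
  have -> : (C * (N * (N - M))) ^+ 2 = C * (N - M) ^+ 2 * (C * N ^+ 2) by ring.
  by rewrite ler_wpM2l // mulr_ge0 ?sqr_ge0.
have -> : '[x - c, x - c] = P - 2 * M + '[c, c].
  by rewrite !jE (jipC A c x) -/M -/P; ring.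
have -> : (M - '[c, c]) ^+ 2 / '[c, c] = M ^+ 2 / '[c, c] - 2 * M + '[c, c].
  by field; rewrite gt_eqF.
lra.
Qed.

Lemma primitive_square_cvg (u : nat -> V) :
    (forall k, symmetric_cone A (u k)) ->
  (fun k => '[u k, e]) @ \oo --> '[c, c] ->
  (fun k => '[u k, c]) @ \oo --> '[c, c] ->
  jcvg A u c.
Proof.
move=> u_cone ue uc; have [C distC] := primitive_square_dist.
have ues : (fun k => '[u k, e] - '[c, c]) @ \oo --> '[c, c] - '[c, c].
  exact: (cvgB ue (cvg_cst _)).
apply: (jcvg_squeeze _
  (cvgMl_tmp (a := C) (cvgD (cvgM ues ues)
    (cvgMl_tmp (a := 36 * '[c, c]) (cvgB ue uc))))) => [k|].
  by have [y _ yy] := u_cone k; have := distC y; rewrite (yy : y ** y = u k).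
by rewrite !subrr; ring.
Qed.

Lemma primitive_dual_cvg (u : nat -> V) :
    (forall k y, 0 <= '[u k, y ** y]) ->
  (fun k => '[u k, e]) @ \oo --> '[c, c] ->
  (fun k => '[u k, c]) @ \oo --> '[c, c] ->
  jcvg A u c.
Proof.
move=> u_dual ue uc; have [C distC] := primitive_dual_dist.
have ucs : (fun k => '[u k, c] - '[c, c]) @ \oo --> '[c, c] - '[c, c].
  exact: (cvgB uc (cvg_cst _)).
apply: (jcvg_squeeze _ (cvgD (cvgMr_tmp (b := '[c, c]^-1) (cvgM ucs ucs))
  (cvgMl_tmp (a := C) (cvgM ue (cvgB ue uc))))) => [k|].
  exact: (distC _ (u_dual k)).
by rewrite !subrr; ring.
Qed.

End Primitive.

(** * Convergence on the Jordan frame *)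

Section Frame.
Context {n : nat} {c : 'I_n -> V} (frame : jordan_frame A c).

Let cc i : c i ** c i = c i.
Proof. by have [prim _ _] := frame; case: (prim i) => -[]. Qed.

Let cij i j : i != j -> c i ** c j = 0.
Proof. by have [_ orth _] := frame; exact: orth. Qed.

Let sum_c : \sum_i c i = e.
Proof. by have [] := frame. Qed.

Lemma frame_orthogonal i j : i != j -> '[c i, c j] = 0.
Proof. by move=> ij; rewrite -(cc i) jip_prod cij // jip0r. Qed.

Lemma frame_square (lam : 'I_n -> R) :
  jsquare A (\sum_i lam i *: c i) = \sum_i lam i ^+ 2 *: c i.
Proof.
rewrite /jsquare jprod_suml; apply: eq_bigr => i _.
rewrite jprod_sumr (bigD1 i) //= big1 => [|j ji].
  by rewrite addr0 jprodZl jprodZr cc scalerA -expr2.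
by rewrite jprodZl jprodZr cij ?scaler0 // eq_sym.
Qed.

Context {lam : 'I_n -> R} (lam_inj : injective lam).
Let p := \sum_i lam i *: c i.

(* [(p - lam j *: e) ^ 2] is a combination of the [c i], i != j, with positive
   coefficients, and is orthogonal to [c j]. *)
Lemma frame_shift_square j :
  jsquare A p - (2 * lam j) *: p + lam j ^+ 2 *: e =
  \sum_i (lam i - lam j) ^+ 2 *: c i.
Proof.
rewrite frame_square -sum_c !scaler_sumr -sumrB -big_split /=.
apply: eq_bigr => i _; rewrite scalerA -scalerBl -scalerDl; congr (_ *: _).
by ring.
Qed.

Context {T : nat -> 'End(V)} (T_pos : forall k, positive_map A (T k))
  (T_cvg : forall h : V, h \in [:: e; p; jsquare A p] ->
    jcvg A (fun k => T k h) h).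

Let Te w : (fun k => '[T k e, w]) @ \oo --> '[e, w].
Proof. by move: w; apply/jcvgP/T_cvg; rewrite mem_head. Qed.
Let Tp w : (fun k => '[T k p, w]) @ \oo --> '[p, w].
Proof. by move: w; apply/jcvgP/T_cvg; rewrite !inE eqxx orbT. Qed.
Let Tpp w : (fun k => '[T k (jsquare A p), w]) @ \oo --> '[jsquare A p, w].
Proof. by move: w; apply/jcvgP/T_cvg; rewrite !inE eqxx !orbT. Qed.

Let T_frame_ge0 i j k : 0 <= '[T k (c i), c j].
Proof.
apply: symmetric_cone_idem (cc j); apply: T_pos.
by exists (c i); rewrite ?/jsquare.
Qed.

Lemma positive_offdiag_cvg i j : i != j ->
  (fun k => '[T k (c i), c j]) @ \oo --> (0 : R).
Proof.
move=> ij; pose q := \sum_i (lam i - lam j) ^+ 2 *: c i.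
have qj : '[q, c j] = 0.
  rewrite jip_suml big1 // => l _; rewrite jipZl.
  have [->|lj] := eqVneq l j; first by rewrite subrr expr0n mul0r.
  by rewrite frame_orthogonal ?mulr0.
have Tq : (fun k => '[T k q, c j]) @ \oo --> (0 : R).
  rewrite -qj /q -frame_shift_square.
  have expand (S : 'End(V)) :
      '[S (jsquare A p - (2 * lam j) *: p + lam j ^+ 2 *: e), c j] =
      '[S (jsquare A p), c j] - 2 * lam j * '[S p, c j] +
      lam j ^+ 2 * '[S e, c j].
    have SZ a x : S (a *: x) = a *: S x by rewrite linearZ.
    by rewrite linearD linearB /= !SZ !jE; ring.
  under eq_fun do rewrite expand.
  (* The same expansion for the identity map puts the limit in matching form. *)
  have := expand \1%VF; rewrite !lfunE /= => ->.
  exact: (cvgD (cvgB (@Tpp (c j)) (cvgMl_tmp (a := 2 * lam j) (@Tp (c j))))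
    (cvgMl_tmp (a := lam j ^+ 2) (@Te (c j)))).
have d_gt0 : 0 < (lam i - lam j) ^+ 2.
  by rewrite exprn_even_gt0 //= subr_eq0 (inj_eq lam_inj).
have Tq' : (fun k => ((lam i - lam j) ^+ 2)^-1 * '[T k q, c j]) @ \oo -->
    (0 : R).
  by rewrite -(mulr0 ((lam i - lam j) ^+ 2)^-1); exact: cvgMl_tmp.
apply: (squeeze_cvgr _ (cvg_cst 0) Tq'); apply: nearW => k /=.
(* All terms of <T k q, c j> are nonnegative, so the one of index [i] is at most the whole sum. *)
rewrite T_frame_ge0 ler_pdivlMl // /q linear_sum jip_suml (bigD1 i) //=.
rewrite linearZ jipZl lerDl sumr_ge0 // => l _.
by rewrite linearZ jipZl; exact: mulr_ge0 (sqr_ge0 _) (T_frame_ge0 _ _ _).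
Qed.

Lemma positive_diag_cvg i j :
  (fun k => '[T k (c i), c j]) @ \oo --> '[c i, c j].
Proof.
have [<-|ij] := eqVneq i j; last first.
  by rewrite frame_orthogonal //; exact: positive_offdiag_cvg.
have diagE (S : 'End(V)) : '[S (c i), c i] =
    '[S e, c i] - \sum_(l | l != i) '[S (c l), c i].
  by rewrite -sum_c linear_sum jip_suml (bigD1 i) //= addrK.
under eq_fun do rewrite diagE.
have := diagE \1%VF; rewrite !id_lfunE => ->; under eq_bigr do rewrite id_lfunE.
have sum_cvg : (fun k => \sum_(l | l != i) '[T k (c l), c i]) @ \oo -->
    \sum_(l | l != i) '[c l, c i].
  apply: cvg_sumr => l li.
  by rewrite frame_orthogonal //; exact: positive_offdiag_cvg.
exact: (cvgB (@Te (c i)) sum_cvg).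
Qed.

(** [T k (c i)] is a square, while its adjoint counterpart is only seen to pair nonnegatively with
    squares, whence the two separate criteria. *)
Lemma positive_frame_cvg i :
  jcvg A (fun k => T k (c i)) (c i) /\
  jcvg A (fun k => adjoint A (T k) (c i)) (c i).
Proof.
have [prim _ _] := frame.
have ce : '[c i, c i] = '[c i, e].
  by rewrite -[X in _ = '[X, _]](cc i) jip_prod jprodx1.
split.
  apply: (primitive_square_cvg (prim i)); last exact: positive_diag_cvg.
    by move=> k; apply: T_pos; exists (c i); rewrite ?/jsquare.
  rewrite ce -sum_c jip_sumr.
  under eq_fun do rewrite jip_sumr.
  by apply: cvg_sumr => j _; exact: positive_diag_cvg.
apply: (primitive_dual_cvg (prim i)).
- move=> k y; rewrite jipC -adjointP; apply: symmetric_cone_idem => //.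
  by apply: T_pos; exists y.
- under eq_fun do rewrite jipC -adjointP.
  by rewrite ce (jipC A (c i)); exact: Te.
under eq_fun do rewrite jipC -adjointP.
exact: positive_diag_cvg.
Qed.

End Frame.
End Algebra.

(** * Extension to the span by linearity *)

Theorem theorem5p1 (R : realType) (V : vectType R)
    (A : euclideanJordanAlgebra V) (n : nat) (rankA : has_rank A n)
    (p : V) (lam : 'I_n -> R) (c : 'I_n -> V)
    (spec_p : spectral_decomposition A p lam c) (lam_distinct : injective lam)
    (T : nat -> 'End(V)) (T_pos : forall k, positive_map A (T k))
    (T_cvg : forall h : V, h \in [:: junit A; p; jsquare A p] ->
      jcvg A (fun k => T k h) h) :
  forall h : V, h \in <<codom c>>%VS ->
    jcvg A (fun k => T k h) h /\ jcvg A (fun k => adjoint A (T k) h) h.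
Proof.
have [frame pE] := spec_p; rewrite pE in T_cvg.
have frame_cvg := positive_frame_cvg frame lam_distinct T_pos T_cvg.
move=> h hc.
have [a ->] : exists a : 'I_n -> R, h = \sum_i a i *: c i.
  (* [codom_tuple c] is indexed by the ordinals below the cardinal of 'I_n, hence the passage
     through [enum_rank]. *)
  exists (fun i => coord (codom_tuple c) (enum_rank i) h).
  rewrite {1}(coord_span (hc : h \in <<codom_tuple c>>%VS)).
  rewrite (reindex enum_rank) /=; last exact/onW_bij/enum_rank_bij.
  by apply: eq_bigr => i _; rewrite nth_codom enum_rankK.
split; apply/jcvgP => w; rewrite jip_suml;
  under eq_fun do rewrite linear_sum jip_suml;
  apply: cvg_sumr => i _; rewrite jipZl;
  under eq_fun do rewrite linearZ jipZl;
  apply: cvgMl_tmp; have [/jcvgP T1 /jcvgP T2] := frame_cvg i; exact.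
Qed.
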